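(* Let $n\ge 3$. There exists a group $G$ that is elementarily equivalent to $\mathrm{GL}_n(\mathbb{Q})$ (in the language of groups) but is not isomorphic to $\mathrm{GL}_n(F)$ for any field $F$.
   Context: Two groups are elementarily equivalent if they satisfy the same first-order sentences in the language of groups. $\mathbb{Q}$ is the field of rational numbers. *)

(* Defs.v *)
From HB Require Import structures.
From mathcomp Require Import all_boot all_order all_algebra all_fingroup.

Set Implicit Arguments.
Unset Strict Implicit.
Unset Printing Implicit Defensive.

Local Open Scope group_scope.

Inductive gterm : Type :=
| GVar of nat
| GOne
| GMul of gterm & gterm
| GInv of gterm.

(* The remaining connectives and the universal quantifier are the usual
   abbreviations of classical logic. *)
Inductive gformula : Type :=
| GEq of gterm & gterm
| GNot of gformula
| GAnd of gformula & gformula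
| GEx of nat & gformula.

Fixpoint gterm_vars (t : gterm) : seq nat :=
  match t with
  | GVar i => [:: i]
  | GOne => [::]
  | GMul s t => gterm_vars s ++ gterm_vars t
  | GInv t => gterm_vars t
  end.

Fixpoint gfree_vars (f : gformula) : seq nat :=
  match f with
  | GEq s t => gterm_vars s ++ gterm_vars t
  | GNot f => gfree_vars f
  | GAnd f g => gfree_vars f ++ gfree_vars g
  | GEx i f => [seq j <- gfree_vars f | j != i]
  end.

Definition gsentence (f : gformula) : Prop := gfree_vars f = [::].

Section Semantics.
Variable G : groupType.
Implicit Type e : nat -> G.

Fixpoint geval e (t : gterm) : G :=
  match t with
  | GVar i => e i
  | GOne => 1
  | GMul s t => geval e s * geval e t
  | GInv t => (geval e t)^-1
  end.

Fixpoint gholds e (f : gformula) : Prop :=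
  match f with
  | GEq s t => geval e s = geval e t
  | GNot f => ~ gholds e f
  | GAnd f g => gholds e f /\ gholds e g
  | GEx i f => exists x : G, gholds [eta e with i |-> x] f
  end.

(* For a sentence the assignment is irrelevant. *)
Definition gmodels (f : gformula) : Prop := forall e, gholds e f.

End Semantics.

Definition elementarily_equivalent (G H : groupType) : Prop :=
  forall f : gformula, gsentence f -> (gmodels G f <-> gmodels H f).

Definition group_isomorphic (G H : groupType) : Prop :=
  exists f : {multiplicative G -> H}, bijective f.

(* The library's ['GL_n[R]] is only available for finite [R]. *)
Definition GL (n : nat) (R : comUnitRingType) : Type :=
  {A : 'M[R]_n | A \in unitmx}.

HB.instance Definition _ n R := SubChoice.on (GL n R).

Section GLGroup.
Variables (n : nat) (R : comUnitRingType).
Implicit Types A B C : GL n R.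

Fact GL_mul_subproof A B : (val A *m val B)%R \in unitmx.
Proof. by rewrite unitmx_mul (valP A) (valP B). Qed.

Fact GL_inv_subproof A : invmx (val A) \in unitmx.
Proof. by rewrite unitmx_inv (valP A). Qed.

Definition GL_one : GL n R := Sub 1%:M%R (unitmx1 R n).
Definition GL_mul A B : GL n R := Sub (val A *m val B)%R (GL_mul_subproof A B).
Definition GL_inv A : GL n R := Sub (invmx (val A)) (GL_inv_subproof A).

Fact GL_mulA : associative GL_mul.
Proof. by move=> A B C; apply: val_inj; rewrite /= mulmxA. Qed.

Fact GL_mul1 : left_id GL_one GL_mul.
Proof. by move=> A; apply: val_inj; rewrite /= mul1mx. Qed.

Fact GL_mulr1 : right_id GL_one GL_mul.
Proof. by move=> A; apply: val_inj; rewrite /= mulmx1. Qed.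

Fact GL_mulV : left_inverse GL_one GL_inv GL_mul.
Proof. by move=> A; apply: val_inj; rewrite /= mulVmx ?(valP A). Qed.

Fact GL_mulrV : right_inverse GL_one GL_inv GL_mul.
Proof. by move=> A; apply: val_inj; rewrite /= mulmxV ?(valP A). Qed.

HB.instance Definition _ :=
  isGroup.Build (GL n R) GL_mulA GL_mul1 GL_mulr1 GL_mulV GL_mulrV.

End GLGroup.

(* Main.v *)
Require Import Defs.
From HB Require Import structures.
From mathcomp Require Import all_boot all_order all_algebra all_fingroup.
From mathcomp Require Import zify ring.
From mathcomp Require Import boolp functions.

(** The witness is G = GL_n(Q) x D, where D is the additive group of a rational
    vector space of uncountable dimension.

    Elementary equivalence.  Let v be the 2-adic valuation of the determinant.
    A matrix g is determined by its class modulo the central subgroup generated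
    by 2I together with the integer v(g), and v(2I) = n.  Thus GL_n(Q) is the
    fibre product, over Z/n, of GL_n(Q)/<2I> and Z, and GL_n(Q) x D is the same
    fibre product with Z x D in place of Z.  The abelian groups Z and Z x D,
    equipped with the residues modulo every N of the integer component, satisfy
    the same sentences: both are torsion-free, and an element is divisible by N
    exactly when its integer component is.  Playing equal classes in the first
    factor and the strategy for Z against Z x D in the second one gives a
    back-and-forth between the two fibre products.

    The positions of that game are described by [agree]: at precision L,
    corresponding matrices differ by a power of 2I whose exponent is a multiple
    of L!, and the pairs (v(g), d) satisfy the same integral linear relations
    with coefficients at most L in absolute value.  Each quantifier costs a
    passage from precision 2L^2 to L ([agree_extend]), and each formula is
    decided at some finite precision ([agree_holds]).  The argument only uses a
    group with a map v to the integers and central powers of an element on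
    which v is nonzero, so it is carried out in that setting
    ([divisible_factor_elementarily_equivalent]).

    Non-isomorphism.  Suppose that GL_n(F) is isomorphic to P x D.  The factor D
    is central, so it consists of scalar matrices and embeds into F.  Conversely
    F embeds into P: two transvections along the same root with the same
    component in P differ by a central element, hence by a scalar, hence are
    equal.  So D embeds into P ([embedding_of_GL_isomorphic_prod]), which is
    impossible for P = GL_n(Q) countable and D uncountable. *)

Set Implicit Arguments.
Unset Strict Implicit.
Unset Printing Implicit Defensive.

Import Order.TTheory GRing.Theory Num.Theory.
Local Open Scope ring_scope.

(** * Isomorphic groups are elementarily equivalent *)

Lemma isomorphic_elementarily_equivalent (G H : groupType) :
  group_isomorphic G H -> elementarily_equivalent G H.
Proof.
case=> f [g fK gK].
have ev e e' : (forall i, e' i = f (e i)) ->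
    forall t, geval e' t = f (geval e t).
  have f1 : f 1%g = 1%g by apply: (mulgI (f 1%g)); rewrite -gmulfM !mulg1.
  move=> ee'; elim=> [i||s IHs t IHt|t IHt] //=.
  - by rewrite IHs IHt gmulfM.
  - by apply: (mulgI (f (geval e t))); rewrite IHt -gmulfM !mulgV f1.
have holds phi : forall e e', (forall i, e' i = f (e i)) ->
    gholds e phi <-> gholds e' phi.
  elim: phi => [s t|phi IH|phi IHphi psi IHpsi|i phi IH] e e' ee' /=.
  - rewrite !(ev _ _ ee'); split=> [->//|]; exact: (can_inj fK).
  - by have := IH _ _ ee'; tauto.
  - by have := IHphi _ _ ee'; have := IHpsi _ _ ee'; tauto.
  - split=> -[x hx].
    + exists (f x); apply: (proj1 (IH [eta e with i |-> x] _ _) hx) => j /=.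
      by case: (j == i).
    + exists (g x); apply: (proj2 (IH _ [eta e' with i |-> x] _) hx) => j /=.
      by case: (j == i); rewrite ?gK.
move=> phi _; split=> mod e.
  by apply/(holds _ (g \o e)) => // i; rewrite /= gK.
exact/(holds _ e (f \o e)).
Qed.

(** * Additive groups and exponents of terms *)

(** An alias of V that carries its addition as a group law, so that direct
    products with multiplicative groups can be formed. *)
Definition additive_group (V : Type) : Type := V.
HB.instance Definition _ (V : zmodType) := Choice.on (additive_group V).
HB.instance Definition _ (V : zmodType) :=
  isGroup.Build (additive_group V) (@addrA V) (@add0r V) (@addr0 V)
    (@addNr V) (@addrN V).

(** The exponent sum of the variable j: the image of t in the free abelian
    group on the variables. *)
Fixpoint gexponent (t : gterm) (j : nat) : int :=
  match t with
  | GVar i => (i == j)%:R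
  | GOne => 0
  | GMul s t => gexponent s j + gexponent t j
  | GInv t => - gexponent t j
  end.

Lemma norm_gexponent t j : `|gexponent t j| <= (size (gterm_vars t))%:Z.
Proof.
elim: t => [i||s IHs t IHt|t IHt] //=.
- by case: eqP.
- by rewrite size_cat; lia.
- by rewrite normrN.
Qed.

(** * The back-and-forth system *)

Section BackAndForth.
(* In the application, P is GL_n(Q), v is the 2-adic valuation of the
   determinant, zeta a is the scalar matrix 2^a and m = n. *)
Variables (P : groupType) (v : P -> int) (zeta : int -> P) (m : int).
Hypothesis vM : forall x y, v (x * y)%g = v x + v y.
Hypothesis zetaD : forall a b, zeta (a + b) = (zeta a * zeta b)%g.
Hypothesis zetaC : forall a x, commute (zeta a) x.
Hypothesis v_zeta : forall a, v (zeta a) = m * a.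
Hypothesis m_neq0 : m != 0.

Let v1 : v 1%g = 0.
Proof. by apply: (addrI (v 1%g)); rewrite -vM mulg1 addr0. Qed.

Let vV x : v x^-1%g = - v x.
Proof. by apply: (addrI (v x)); rewrite -vM mulgV v1 subrr. Qed.

Let zeta0 : zeta 0 = 1%g.
Proof. by apply: (mulgI (zeta 0)); rewrite -zetaD mulg1 addr0. Qed.

Let zetaN a : zeta (- a) = (zeta a)^-1%g.
Proof. by apply: (mulgI (zeta a)); rewrite -zetaD mulgV subrr zeta0. Qed.

Section Weight.
Variable D : lmodType rat.
Implicit Type e : nat -> P * additive_group D.

(** The image of an element of P x D in Z x D, inside the rational vector space
    Q x D where relations can be solved by division. *)
Definition weight (x : P * additive_group D) : rat^o * D :=
  ((v x.1)%:~R, x.2).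

Definition weight_comb (X : seq nat) (c : nat -> int) e : rat^o * D :=
  \sum_(j <- X) (c j)%:~R *: weight (e j).

Lemma weightM x y : weight (x * y)%g = weight x + weight y.
Proof. by congr pair; rewrite /= vM rmorphD. Qed.

Lemma weight1 : weight 1%g = 0.
Proof. by congr pair; rewrite /= v1. Qed.

Lemma weightV x : weight x^-1%g = - weight x.
Proof. by congr pair; rewrite /= vV rmorphN. Qed.

Lemma weight_geval X e t : uniq X -> {subset gterm_vars t <= X} ->
  weight (geval e t) = weight_comb X (gexponent t) e.
Proof.
move=> uX; rewrite /weight_comb; elim: t => [i||s IHs t IHt|t IHt] /= tX.
- rewrite (bigD1_seq i) ?tX ?mem_head //= eqxx scale1r big1 ?addr0 // => j.
  by rewrite eq_sym => /negPf->; rewrite scale0r.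
- by rewrite weight1 big1 // => j; rewrite scale0r.
- rewrite weightM IHs ?IHt => [|x xt|x xs].
  + by rewrite -big_split; apply: eq_bigr => j; rewrite rmorphD scalerDl.
  + by apply: tX; rewrite mem_cat xt orbT.
  + by apply: tX; rewrite mem_cat xs.
- by rewrite weightV IHt // -sumrN; apply: eq_bigr => j; rewrite rmorphN scaleNr.
Qed.

Lemma weight_comb_fst X c e :
  (weight_comb X c e).1 = (\sum_(j <- X) c j * v (e j).1)%:~R.
Proof.
rewrite /weight_comb raddf_sum rmorph_sum.
by apply: eq_bigr => j _ /=; rewrite -[LHS]rmorphM.
Qed.

(** Assigning x to the variable i discards the previous value of i, whose
    coefficient is therefore set to zero in the combination of e. *)
Lemma weight_comb_update X c e i x :
  weight_comb (i :: [seq j <- X | j != i]) c [eta e with i |-> x] =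
  (c i)%:~R *: weight x + weight_comb X [eta c with i |-> 0] e.
Proof.
rewrite /weight_comb big_cons /= eqxx big_filter; congr (_ + _).
rewrite big_mkcond; apply: eq_bigr => j _.
by case: (j == i) => //=; rewrite scale0r.
Qed.

Lemma weight_comb_lin X (a b : int) c c' e :
  weight_comb X (fun j => a * c j + b * c' j) e =
  a%:~R *: weight_comb X c e + b%:~R *: weight_comb X c' e.
Proof.
rewrite /weight_comb !scaler_sumr -big_split; apply: eq_bigr => j _.
by rewrite rmorphD !rmorphM scalerDl !scalerA.
Qed.

End Weight.

(** One relation with nonzero coefficient at x turns every other relation
    involving x into a relation without x.  The new coefficients are differences
    of two products of old ones, so 2L^2 bounds them when L bounds the old
    ones. *)
Lemma eliminate (W : lmodType rat) (c c' : int) (x A B : W) : c != 0 ->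
  c%:~R *: x + A = 0 ->
  c'%:~R *: x + B = 0 <-> c%:~R *: B + (- c')%:~R *: A = 0.
Proof.
move=> c0 /eqP; rewrite addr_eq0 => /eqP cx.
have cQ : c%:~R != 0 :> rat by rewrite intr_eq0.
have -> : c%:~R *: B + (- c')%:~R *: A = c%:~R *: (c'%:~R *: x + B).
  rewrite scalerDr scalerA mulrC -scalerA cx scalerN rmorphN scaleNr.
  by rewrite addrC.
split=> [->|]; first by rewrite scaler0.
by move/eqP; rewrite scaler_eq0 (negPf cQ) => /eqP.
Qed.

(** The positions of the game.  The single parameter L bounds the coefficients
    of the linear relations that are compared, and makes the exponents of zeta
    divisible by L!, that is, by all integers from 1 to L. *)
Definition agree (D D' : lmodType rat) (X : seq nat) (L : nat)
    (e : nat -> P * additive_group D) (e' : nat -> P * additive_group D') :=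
  (exists s : nat -> int,
     {in X, forall j, (e' j).1 = (zeta (L`!%:Z * s j) * (e j).1)%g}) /\
  (forall c : nat -> int, (forall j, `|c j| <= L%:Z) ->
     weight_comb X c e = 0 <-> weight_comb X c e' = 0).

Lemma agree_sym (D D' : lmodType rat) X L (e : nat -> P * additive_group D)
    (e' : nat -> P * additive_group D') :
  agree X L e e' -> agree X L e' e.
Proof.
case=> [[s es] lin]; split; last by move=> c /lin[].
exists (fun j => - s j) => j jX.
by rewrite es // mulgA -zetaD mulrN addNr zeta0 mul1g.
Qed.

Lemma agree_leq (D D' : lmodType rat) X L L' (e : nat -> P * additive_group D)
    (e' : nat -> P * additive_group D') :
  (L <= L')%N -> agree X L' e e' -> agree X L e e'.
Proof.
move=> LL' [[s es] lin]; split; last first.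
  by move=> c cL; apply: lin => j; apply: le_trans (cL j) _; rewrite lez_nat.
have /dvdnP[q Eq] : (L`! %| L'`!)%N.
  by rewrite -(bin_fact LL') dvdn_mull ?dvdn_mulr.
exists (fun j => q%:Z * s j) => j jX.
by rewrite es // Eq PoszM mulrA (mulrC q%:Z).
Qed.

Lemma zeta_geval (D D' : lmodType rat) X (e : nat -> P * additive_group D)
    (e' : nat -> P * additive_group D') (s : nat -> int) t :
  uniq X -> {subset gterm_vars t <= X} ->
  {in X, forall j, (e' j).1 = (zeta (s j) * (e j).1)%g} ->
  (geval e' t).1 =
    (zeta (\sum_(j <- X) gexponent t j * s j)%R * (geval e t).1)%g.
Proof.
move=> uX + es; elim: t => [i||a IHa b IHb|a IHa] /= tX.
- have iX : i \in X by rewrite tX ?mem_head.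
  rewrite (bigD1_seq i) //= eqxx mul1r big1 ?addr0 ?es // => j.
  by rewrite eq_sym => /negPf->; rewrite mul0r.
- by rewrite big1 ?zeta0 ?mulg1 // => j; rewrite mul0r.
- under eq_bigr do rewrite mulrDl.
  rewrite big_split zetaD IHa ?IHb => [|x xt|x xs].
  + by rewrite -!mulgA; congr (_ * _)%g; rewrite !mulgA zetaC.
  + by apply: tX; rewrite mem_cat xt orbT.
  + by apply: tX; rewrite mem_cat xs.
- under eq_bigr do rewrite mulNr.
  by rewrite sumrN zetaN IHa // invgM -zetaN zetaC.
Qed.

(** Relations in which the variable i does not occur are inherited from the old
    position; only those in which it occurs have to be checked. *)
Lemma agree_update (D D' : lmodType rat) X L i
    (e : nat -> P * additive_group D) (e' : nat -> P * additive_group D')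
    x (y : P * additive_group D') (t : int) :
  agree X L e e' -> y.1 = (zeta (L`!%:Z * t) * x.1)%g ->
  (forall c : nat -> int, (forall j, `|c j| <= L%:Z) -> c i != 0 ->
    (c i)%:~R *: weight x + weight_comb X [eta c with i |-> 0] e = 0 <->
    (c i)%:~R *: weight y + weight_comb X [eta c with i |-> 0] e' = 0) ->
  agree (i :: [seq j <- X | j != i]) L
    [eta e with i |-> x] [eta e' with i |-> y].
Proof.
case=> [[s es] lin] yt lin_i; split.
  exists [eta s with i |-> t] => j; rewrite inE mem_filter /=.
  by case: eqP => [->|_] //=; apply: es.
move=> c cL; rewrite !weight_comb_update.
have [ci0|/lin_i] := eqVneq (c i) 0; last exact.
rewrite ci0 !scale0r !add0r; apply: lin => j /=.
by case: eqP.
Qed.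

(** The answer y to a move x.  If x satisfies some relation of size at most L
    with the previous elements, with nonzero coefficient c0 i at x, solve the
    corresponding relation for y: divisibility of the exponents by (2L^2)!,
    a multiple of L! times c0 i, makes the solution an element of P x D that
    differs from x by an admissible power of zeta, and all other relations
    follow by elimination.  If x satisfies no such relation, then
    multiplying by a high enough power of zeta gives y an integer component too
    large to satisfy any. *)
Lemma agree_extend (D D' : lmodType rat) X L i
    (e : nat -> P * additive_group D) (e' : nat -> P * additive_group D') x :
  agree X (2 * L * L) e e' ->
  exists y, agree (i :: [seq j <- X | j != i]) L
    [eta e with i |-> x] [eta e' with i |-> y].
Proof.
move=> ee'.
have LL : (L <= 2 * L * L)%N by nia.
have eeL := agree_leq LL ee'.
have [[c0 [c0L c0i c0x]]|indep] := boolp.EM (exists c0 : nat -> int,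
    [/\ forall j, `|c0 j| <= L%:Z, c0 i != 0 &
        (c0 i)%:~R *: weight x + weight_comb X [eta c0 with i |-> 0] e = 0]).
  case: ee' => [[s es] lin].
  have c0L0 j : `|[eta c0 with i |-> 0] j| <= L%:Z by rewrite /=; case: eqP.
  have c0Q : (c0 i)%:~R != 0 :> rat by rewrite intr_eq0.
  (* L >= 1 here, so 2L <= 2L^2 and L! L! divides (2L^2)!, while c0 i divides
     L!; the sign allows for negative c0 i. *)
  have [q Eq] : exists q : int, (2 * L * L)`!%:Z = L`!%:Z * c0 i * q.
    have /dvdnP[a Ea] : (L`! * L`! %| (2 * L * L)`!)%N.
      have L2 : (L + L <= 2 * L * L)%N by have := c0L i; nia.
      rewrite -(bin_fact L2) dvdn_mull ?dvdn_mulr //.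
      by rewrite -(bin_fact (leq_addl L L)) addnK dvdn_mull.
    have /dvdnP[b Eb] : (`|c0 i|%N %| L`!)%N.
      by apply: dvdn_fact; have := c0L i; lia.
    exists (a%:Z * b%:Z * Num.sg (c0 i)); rewrite Ea PoszM {2}Eb.
    have -> : (L`! * (b * `|c0 i|))%N%:Z = L`!%:Z * (b%:Z * `|c0 i|).
      by rewrite !PoszM abszE.
    by rewrite [`|c0 i|]normrEsg; ring.
  (* The exponent t is forced by c0 i (v x + m L! t) + ... = 0, the other
     exponents contributing m (2L^2)! T to the sum. *)
  pose T := \sum_(j <- X) [eta c0 with i |-> 0] j * s j.
  pose A' := weight_comb X [eta c0 with i |-> 0] e'.
  pose y : P * additive_group D' :=
    ((zeta (L`!%:Z * - (q * T)) * x.1)%g, - (c0 i)%:~R^-1 *: A'.2).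
  have c0y : (c0 i)%:~R *: weight y + A' = 0.
    apply/eqP; rewrite -pair_eqE; apply/andP; split; apply/eqP => /=; last first.
      by rewrite scaleNr scalerN scalerA divff // scale1r addNr.
    rewrite weight_comb_fst -[_ *: _]rmorphM -rmorphD vM v_zeta.
    have -> : \sum_(j <- X) [eta c0 with i |-> 0] j * v (e' j).1 =
        m * ((2 * L * L)`!%:Z * T) +
        \sum_(j <- X) [eta c0 with i |-> 0] j * v (e j).1.
      rewrite /T !mulr_sumr -big_split; apply: eq_big_seq => j jX.
      by rewrite es // vM v_zeta /=; move: (_`!%:Z) => F; ring.
    have /(congr1 fst) /= := c0x.
    rewrite weight_comb_fst -[_ *: _]rmorphM -rmorphD => /eqP.
    rewrite intr_eq0 => /eqP c0v; apply/eqP.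
    by rewrite intr_eq0; apply/eqP/(etrans _ c0v); rewrite Eq; ring.
  exists y; apply: (agree_update eeL (t := - (q * T))) => // c cL ci.
  rewrite (eliminate _ _ c0i c0x) (eliminate _ _ c0i c0y) -!weight_comb_lin.
  apply: lin => j.
  have cj : `|[eta c with i |-> 0] j| <= L%:Z by rewrite /=; case: eqP.
  apply: le_trans (ler_normD _ _) _; rewrite !normrM normrN.
  have -> : (2 * L * L)%N%:Z = L%:Z * L%:Z + L%:Z * L%:Z by lia.
  by rewrite lerD // ler_pM.
(* B bounds the integer part of every relevant combination of the e' j. *)
pose B := L%:Z * \sum_(j <- X) `|v (e' j).1|.
pose t := B + `|v x.1| + 1.
pose y : P * additive_group D' := ((zeta (L`!%:Z * t) * x.1)%g, 0).
exists y; apply: (agree_update eeL (t := t)) => // c cL ci.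
split=> [cx|]; first by case: indep; exists c.
move/(congr1 fst) => /=; rewrite weight_comb_fst -[_ *: _]rmorphM -rmorphD.
move/eqP; rewrite intr_eq0 vM v_zeta addr_eq0 => /eqP cy.
have : `|c i * (m * (L`!%:Z * t) + v x.1)| <= B.
  rewrite cy normrN (le_trans (ler_norm_sum _ _ _)) // /B mulr_sumr.
  apply: ler_sum => j _; rewrite normrM ler_wpM2r //=.
  by case: eqP.
have B0 : 0 <= B by rewrite /B mulr_ge0 // sumr_ge0.
set u := m * _ => cu.
have t0 : 0 <= t by rewrite /t -addrA addr_ge0 // addr_ge0.
have tu : t <= `|u|.
  rewrite /u mulrA normrM (ger0_norm t0) ler_peMl // -gtz0_ge1 normr_gt0.
  by rewrite mulf_neq0 // -lt0n fact_gt0.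
have uB : `|u + v x.1| <= B.
  apply: le_trans cu; rewrite normrM ler_peMl // -gtz0_ge1 normr_gt0 //.
by move: tu uB; rewrite /t; lia.
Qed.

(** If w(e) = 1, the exponents of w give a relation of the weights; it transfers
    to e', so w(e') has weight zero.  But w(e') differs from w(e) = 1 by a
    power of zeta, on which v vanishes only at exponent 0. *)
Lemma agree_geval1 (D D' : lmodType rat) X w (e : nat -> P * additive_group D)
    (e' : nat -> P * additive_group D') :
  uniq X -> {subset gterm_vars w <= X} ->
  agree X (size (gterm_vars w)) e e' ->
  geval e w = 1%g -> geval e' w = 1%g.
Proof.
move=> uX wX [[s es] lin] ew.
have /lin[+ _] : forall j, `|gexponent w j| <= (size (gterm_vars w))%:Z.
  by move=> j; apply: norm_gexponent.
rewrite -!weight_geval // ew weight1 => /(_ erefl) ew'.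
have e1 := zeta_geval uX wX es; move: e1 ew'; rewrite ew mulg1.
case: (geval e' w) => x d /= -> /eqP; rewrite -pair_eqE => /andP[/= + /eqP ->].
rewrite intr_eq0 v_zeta mulf_eq0 (negPf m_neq0) => /eqP->.
by rewrite zeta0.
Qed.

(** The precision depends on phi alone, not on the assignments: this is what lets
    the induction pass through quantifiers.  Tracking only a list X containing
    the free variables allows X to be empty for a sentence, and any two
    assignments agree over the empty list. *)
Lemma agree_holds (D D' : lmodType rat) phi X :
  uniq X -> {subset gfree_vars phi <= X} ->
  exists L, forall (e : nat -> P * additive_group D)
    (e' : nat -> P * additive_group D'),
  agree X L e e' -> gholds e phi <-> gholds e' phi.
Proof.
elim: phi X => [s t|phi IH|phi IHphi psi IHpsi|i phi IH] X uX /= sX.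
- pose w := GMul s (GInv t).
  exists (size (gterm_vars w)) => e e' ee'.
  have wE (V : lmodType rat) (d : nat -> P * additive_group V) :
      geval d s = geval d t <-> geval d w = 1%g.
    split=> /= st; first by rewrite st mulgV.
    by apply: (mulIg (geval d t)^-1%g); rewrite st mulgV.
  rewrite !wE; split; first exact: (agree_geval1 (w := w) uX sX ee').
  exact: (agree_geval1 (w := w) uX sX (agree_sym ee')).
- have [L HL] := IH X uX sX; exists L => e e' /HL; tauto.
- have [|L HL] := IHphi X uX; first by move=> j jp; rewrite sX // mem_cat jp.
  have [|M HM] := IHpsi X uX.
    by move=> j jp; rewrite sX // mem_cat jp orbT.
  exists (maxn L M) => e e' ee'.
  have := HL _ _ (agree_leq (leq_maxl _ _) ee').
  by have := HM _ _ (agree_leq (leq_maxr _ _) ee'); tauto.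
- have [||L HL] := IH (i :: [seq j <- X | j != i]).
  + by rewrite /= filter_uniq // mem_filter eqxx.
  + move=> j jp; rewrite inE mem_filter; case: eqP => //= /eqP ji.
    by rewrite sX // mem_filter ji.
  exists (2 * L * L)%N => e e' ee'; split=> -[x hx].
  + by have [y /HL[/(_ hx)]] := agree_extend i x ee'; exists y.
  + have [y] := agree_extend i x (agree_sym ee').
    by move/agree_sym/HL=> [_ /(_ hx)]; exists y.
Qed.

Lemma divisible_factor_elementarily_equivalent (D D' : lmodType rat) :
  elementarily_equivalent (P * additive_group D)%type
    (P * additive_group D')%type.
Proof.
move=> phi phi_sentence.
have sub0 : {subset gfree_vars phi <= [::]} by rewrite phi_sentence.
have [L HL] := @agree_holds D D' phi [::] isT sub0.
have ag (e : nat -> P * additive_group D)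
    (e' : nat -> P * additive_group D') : agree [::] L e e'.
  split; first by exists (fun=> 0).
  by move=> c _; rewrite /weight_comb !big_nil.
split=> mod e.
  exact: (proj1 (HL (fun=> 1%g) e (ag _ _)) (mod _)).
exact: (proj2 (HL e (fun=> 1%g) (ag _ _)) (mod _)).
Qed.

End BackAndForth.

(** * GL_n(Q) absorbs rational vector spaces *)

(** The 2-adic valuation. *)
Definition val2 (x : rat) : int :=
  (logn 2 `|numq x|)%:Z - (logn 2 `|denq x|)%:Z.

Lemma val2M x y : x != 0 -> y != 0 -> val2 (x * y) = val2 x + val2 y.
Proof.
move=> x0 y0.
have E : (`|numq (x * y)| * (`|denq x| * `|denq y|) =
          `|numq x| * `|numq y| * `|denq (x * y)|)%N.
  rewrite -!abszM; congr absz; apply: (@intr_inj rat).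
  rewrite !rmorphM /= !numqE; ring.
move/(congr1 (logn 2)): E.
rewrite !lognM ?muln_gt0 ?absz_gt0 ?numq_eq0 ?denq_eq0 ?mulf_neq0 // /val2;
  last by rewrite x0.
by lia.
Qed.

Lemma val2_2X (s : int) : val2 (2%:Q ^ s) = s.
Proof.
have two0 : 2%:Q != 0 by [].
have nat_case (k : nat) : val2 (2%:Q ^+ k) = k.
  elim: k => [//|k IHk].
  by rewrite exprS val2M ?expf_neq0 // IHk -[k.+1]add1n PoszD.
case: s => k; first exact: nat_case.
apply: (addrI (val2 (2%:Q ^+ k.+1))).
rewrite -val2M ?expf_neq0 ?expfz_neq0 // NegzE -exprnN divff ?expf_neq0 //.
by rewrite nat_case subrr.
Qed.

Section GLRat.
Variable n : nat.
Hypothesis n_gt0 : (0 < n)%N.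

Definition GL_val2 (A : GL n rat) : int := val2 (\det (val A)).

Fact scalar_pow2_unit (s : int) : (2%:Q ^ s)%:M \in @unitmx rat n.
Proof. by rewrite unitmxE det_scalar unitfE expf_neq0 // expfz_neq0. Qed.

Definition scalar_pow2 s : GL n rat := Sub (2%:Q ^ s)%:M (scalar_pow2_unit s).

Lemma GL_det_neq0 (A : GL n rat) : \det (val A) != 0.
Proof. by rewrite -unitfE -unitmxE (valP A). Qed.

Lemma GL_val2M A B : GL_val2 (A * B)%g = GL_val2 A + GL_val2 B.
Proof. by rewrite /GL_val2 /= det_mulmx val2M ?GL_det_neq0. Qed.

Lemma scalar_pow2D a b :
  scalar_pow2 (a + b) = (scalar_pow2 a * scalar_pow2 b)%g.
Proof. by apply: val_inj; rewrite /= -scalar_mxM expfzDr. Qed.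

Lemma scalar_pow2C a x : commute (scalar_pow2 a) x.
Proof. by apply: val_inj; rewrite /= scalar_mxC. Qed.

Lemma GL_val2_scalar a : GL_val2 (scalar_pow2 a) = n%:Z * a.
Proof.
by rewrite /GL_val2 /= det_scalar -[_ ^+ n]/(_ ^ n%:Z) exprz_exp val2_2X mulrC.
Qed.

(** The general lemma compares two products with a vector space; for GL_n(Q)
    itself the zero space is used. *)
Lemma GL_rat_times_divisible (D : lmodType rat) :
  elementarily_equivalent (GL n rat * additive_group D)%type (GL n rat).
Proof.
have triv : group_isomorphic (GL n rat * additive_group 'rV[rat]_0)%type
    (GL n rat).
  by exists fst; exists (fun A => (A, 0)) => // -[A d]; rewrite /= (thinmx0 d).
move=> phi phi_s.
rewrite -(isomorphic_elementarily_equivalent triv phi_s).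
apply: (divisible_factor_elementarily_equivalent GL_val2M scalar_pow2D
  scalar_pow2C GL_val2_scalar) => //.
by rewrite -lt0n.
Qed.

End GLRat.

(** * An abstract factor of GL_n(F) embeds into its complement *)

Lemma transvection_unit (F : fieldType) n (k l : 'I_n) (a : F) :
  k != l -> 1%:M + a *: delta_mx k l \in unitmx.
Proof.
move=> kl; suff /mulmx1_unit[] :
  (1%:M + a *: delta_mx k l) *m (1%:M - a *: delta_mx k l) = 1%:M by [].
rewrite mulmxDl mul1mx mulmxBr mulmx1 -scalemxAl -scalemxAr.
by rewrite mul_delta_mx_0 1?eq_sym // !scaler0 subr0 subrK.
Qed.

Definition transvection (F : fieldType) n (k l : 'I_n) (kl : k != l) (a : F) :
  GL n F := Sub (1%:M + a *: delta_mx k l) (transvection_unit a kl).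

(** Commuting with the transvection 1 + E_kl amounts to commuting with E_kl for
    k <> l: comparing entries kills the off-diagonal part of A and equates its
    diagonal entries. *)
Lemma central_scalar (F : fieldType) n (A : GL n F) (i : 'I_n) :
  (forall B, commute A B) -> val A = (val A i i)%:M.
Proof.
move=> cA.
have cdelta k l : k != l -> val A *m delta_mx k l = delta_mx k l *m val A.
  move=> kl; have /(congr1 val) /= := cA (transvection kl 1).
  by rewrite mulmxDl mulmxDr mul1mx mulmx1 scale1r => /addrI.
have mulE k l p q : (val A *m delta_mx k l) p q = val A p k *+ (q == l).
  rewrite mxE (bigD1 k) //= mxE eqxx /= big1 ?addr0 ?mulr_natr // => r.
  by rewrite mxE => /negPf->; rewrite mulr0.
have mulE' k l p q : (delta_mx k l *m val A) p q = val A l q *+ (p == k).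
  rewrite mxE (bigD1 l) //= mxE eqxx andbT big1 ?addr0 ?mulr_natl // => r.
  by rewrite mxE => /negPf->; rewrite andbF mul0r.
apply/matrixP=> p q; rewrite mxE.
have [<-|pq] := eqVneq p q.
  have [->//|pi] := eqVneq p i.
  have /matrixP/(_ p i) := cdelta _ _ pi.
  by rewrite mulE mulE' !eqxx.
have qp : q != p by rewrite eq_sym.
have /matrixP/(_ p p) := cdelta _ _ qp.
by rewrite mulE mulE' eqxx (negPf pq).
Qed.

(** The embedding of D into P is the composite of D -> F, the scalar by which d
    acts, and F -> P, the component in P of the transvection 1 + a E_ij. *)
Lemma embedding_of_GL_isomorphic_prod (n : nat) (P : groupType)
    (D : zmodType) (F : fieldType) :
  (1 < n)%N -> group_isomorphic (P * additive_group D)%type (GL n F) ->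
  exists h : D -> P, injective h.
Proof.
move=> n1 [f [g fK gK]].
pose i := Ordinal (ltnW n1); pose j := Ordinal n1.
have ij : i != j by [].
have f_central d (B : GL n F) : commute (f (1%g, d)) B.
  rewrite /commute -[B]gK -!gmulfM; congr (f _); case: (g B) => x e.
  by congr pair; rewrite /= ?mulg1 ?mul1g //; apply: addrC.
have fE d := central_scalar i (f_central d).
pose t (a : F) : GL n F := transvection ij a.
exists (fun d => (g (t (val (f (1%g, d)) i i))).1).
have t_inj a b : (g (t a)).1 = (g (t b)).1 -> a = b.
  move=> gab; pose d := (g (t b)).2^-1%g : additive_group D.
  have tab : t a = (t b * f (1%g, d * (g (t a)).2))%g.
    rewrite -[t a]gK -[t b in RHS]gK -gmulfM; congr (f _).
    move: gab; rewrite /d; case: (g (t a)) => x u; case: (g (t b)) => y w /= ->.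
    by congr pair; rewrite /= ?fK /= ?mulg1 ?mulgA ?mulgV ?mul1g.
  (* The two transvections differ by a scalar l; the diagonal entry (i, i) gives
     l = 1 and the entry (i, j) then gives a = b. *)
  have [l fl] : exists l, val (f (1%g, d * (g (t a)).2)%g) = l%:M.
    by eexists; apply: fE.
  move/(congr1 val): tab; rewrite /= [sval (f _)]fl mul_mx_scalar.
  move/matrixP=> tab.
  have := tab i i; have := tab i j.
  rewrite !mxE !eqxx /= !mulr0 !mulr1 addr0 mulr1 !add0r.
  by move=> -> <-; rewrite mul1r.
move=> x y /t_inj xy.
have : f (1%g, x) = f (1%g, y) by apply: val_inj; rewrite fE (fE y) xy.
by move/(can_inj fK) => -[].
Qed.

(** * A group that is elementarily equivalent to GL_n(Q) *)

(** Cantor's diagonal: f differs from the sequence coded by k at the index k. *)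
Lemma cantor_sequences (T : countType) (h : (nat -> rat) -> T) : ~ injective h.
Proof.
move=> h_inj.
pose f k := if boolp.pselect (exists d, pickle (h d) = k) is left H
  then projT1 (boolp.cid H) k + 1 else 0.
have : f (pickle (h f)) = f (pickle (h f)) + 1.
  rewrite {1}/f; case: boolp.pselect => [H|[]]; last by exists f.
  case: boolp.cid => d /= /(pcan_inj pickleK)/h_inj->.
  by [].
move/eqP; rewrite -subr_eq0 opprD addNKr.
by [].
Qed.

Local Close Scope ring_scope.

Theorem mainTheorem13 (n : nat) (hn : 3 <= n) :
  exists G : groupType,
    elementarily_equivalent G (GL n rat) /\
    forall F : fieldType, ~ group_isomorphic G (GL n F).
Proof.
pose D : lmodType rat := (nat -> rat^o).
exists (GL n rat * additive_group D)%type; split.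
  by apply: GL_rat_times_divisible; apply: leq_trans hn.
move=> F; have n1 : (1 < n)%N by apply: leq_trans hn.
move=> /(embedding_of_GL_isomorphic_prod n1)[h h_inj].
apply: (@cantor_sequences 'M[rat]_n (fun d => val (h d))).
by move=> d d' /val_inj/h_inj.
Qed.
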